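(* Let $(G,\mathcal M)$ be a tensor network (with no open legs). A parallel algorithm can contract $(G,\mathcal M)$ in time $$\min_{(T,b)} \max_{l} \sum_{t} 2^{\mathrm{con}(t)},$$ where the minimum is over rooted contraction trees $(T,b)$ of $G$, the maximum is over leaves $l$ of $T$, and the sum is over the vertices $t$ of $T$ on the unique path from $l$ to the root $r$. In other words, the time is the minimum vertex-weighted height of a rooted contraction tree, where vertex $t$ has weight $2^{\mathrm{con}(t)}$. If the contraction is done as matrix multiplications performed in parallel, this bound is tight.
   Context: A tensor network $(G,\mathcal M)$ consists of a finite undirected graph $G$ with positive integer edge weights $w$ and, for each vertex $v$, a complex tensor $\mathbf M_v$ with one index per incident edge, the index for edge $e$ ranging over $[2^{w(e)}]$. Every edge joins two tensors. Contracting two tensors (original or produced by earlier contractions) sums over their shared indices and yields one tensor carrying the remaining indices. Cost model: contracting a tensor with index groups of dimensions $(d_L,d_M)$ with one of dimensions $(d_M,d_R)$ along $d_M$ (a matrix multiplication) takes time $d_L d_M d_R$; reading an initial tensor takes time equal to its number of entries. In the parallel model, contractions of disjoint sets of tensors may be carried out simultaneously; communication costs are ignored. A rooted contraction tree $(T,b)$ of $G$ is a tree $T$ with a designated leaf $r$ (the root), all other vertices of degree $1$ or $3$, together with a bijection $b$ from $V(G)$ to the non-root leaves of $T$; each internal vertex represents the contraction of the two tensors produced by the two subtrees below it. For an edge $\{u,v\}\in E(G)$, its routing is the unique path in $T$ between $b(u)$ and $b(v)$. The congestion $\mathrm{con}(t)$ of a vertex $t\in V(T)$ is the total weight of edges of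 $G$ whose routings contain $t$.
   Formalization: The root has congestion 0 and contributes 1 to the sum, though the cost model charges nothing for it, so the bound is never attained exactly; tightness is stated as: the minimum parallel time plus 1 equals the bound. G is assumed to have at least one vertex. *)

(* Defs.v *)
From HB Require Import structures.
From mathcomp Require Import all_boot all_order all_algebra.
From mathcomp Require Import boolp reals complex.

Set Implicit Arguments.
Unset Strict Implicit.
Unset Printing Implicit Defensive.

Import GRing.Theory.

(* Parallel edges are allowed; a simple graph is the case where [ends] is
   injective. An edge has exactly two endpoints, so there are neither loops nor
   open legs. *)
Record weighted_graph := WeightedGraph {
  vertex : finType;
  edge : finType;
  ends : edge -> {set vertex};
  weight : edge -> nat;
  card_ends : forall e, #|ends e| = 2;
  weight_gt0 : forall e, 0 < weight e }.

Definition incident (G : weighted_graph) (v : vertex G) : {set edge G} :=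
  [set e | v \in ends e].

Definition assignment (G : weighted_graph) : finType :=
  {dffun forall e : edge G, 'I_(2 ^ weight e)}.

(* A tensor with index set [legs] is encoded as a function of the values of all
   the edge indices that depends only on those in [legs]. *)
Record tensor (R : realType) (G : weighted_graph) := Tensor {
  legs : {set edge G};
  entry : assignment G -> R[i];
  entry_local : forall x y : assignment G,
    (forall e, e \in legs -> x e = y e) -> entry x = entry y }.

Record tensor_network (R : realType) := TensorNetwork {
  graph :> weighted_graph;
  tensor_at : vertex graph -> tensor R graph;
  legs_tensor_at : forall v, legs (tensor_at v) = incident v }.

Definition network_value (R : realType) (N : tensor_network R) : R[i] :=
  (\sum_(x : assignment N) \prod_(v : vertex N) entry (tensor_at v) x)%R.

Section Contraction.
Variables (R : realType) (G : weighted_graph).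
Implicit Types (A B : tensor R G) (S : {set edge G}) (x y z : assignment G).

Definition contract_legs A B : {set edge G} :=
  (legs A :\: legs B) :|: (legs B :\: legs A).

Definition agree_off S x z : bool := [forall e, (e \notin S) ==> (z e == x e)].

(* The sum ranges over the values of the shared indices: [z] is equal to [x]
   on all the other ones. *)
Definition contract_entry A B x : R[i] :=
  (\sum_(z | agree_off (legs A :&: legs B) x z) entry A z * entry B z)%R.

Lemma contract_entry_local A B x y :
  (forall e, e \in contract_legs A B -> x e = y e) ->
  contract_entry A B x = contract_entry A B y.
Proof.
move=> xy; rewrite /contract_entry.
set S := legs A :&: legs B.
pose glue (u z : assignment G) : assignment G :=
  [ffun e => if e \in S then z e else u e].
have glueK u v z : agree_off S u z -> glue u (glue v z) = z.
  move=> /forallP uz; apply/ffunP => e; rewrite !ffunE.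
  by have := uz e; case: (e \in S) => //= /eqP.
have glueP u z : agree_off S u (glue u z).
  by apply/forallP => e; rewrite !ffunE; case: (e \in S) => /=.
rewrite (reindex_onto (glue x) (glue y)) => [|z]; last exact: glueK.
apply: eq_big => [z|z /andP[_ /eqP <-]].
  rewrite glueP /=; apply/eqP/idP => [<-|]; [exact: glueP | exact: glueK].
congr (_ * _)%R; apply: entry_local => e le; rewrite !ffunE;
  case: ifPn => [-> // | eS]; apply: xy;
  by move: eS; rewrite !inE le ?andbT ?andbF /= ?orbF => ->.
Qed.

Definition contract A B : tensor R G := Tensor (@contract_entry_local A B).

Definition dim S : nat := \prod_(e in S) 2 ^ weight e.

(* d_L * d_M * d_R, where M is the group of shared indices. *)
Definition matmul_time A B : nat :=
  dim (legs A :\: legs B) * dim (legs A :&: legs B) * dim (legs B :\: legs A).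

End Contraction.

(* A parallel algorithm is a list of instructions, each carrying its own
   starting time. Instructions may overlap in time: the order of the list
   only records dependencies. There is a memory cell for each vertex;
   [Read v t] loads the initial tensor of [v] in cell [v], and [Mul u v t]
   contracts the tensors of cells [u] and [v] and stores the result in
   cell [u]. *)
Inductive instruction (V : Type) :=
  | Read (v : V) (start : nat)
  | Mul (u v : V) (start : nat).

Arguments Read {V} v start.
Arguments Mul {V} u v start.

Section Algorithm.
Variables (R : realType) (N : tensor_network R).

(* [Avail A t] holds the tensor [A], whose computation is complete at time
   [t]. *)
Inductive cell :=
  | Unread
  | Avail (A : tensor R N) (t : nat)
  | Consumed.

Definition state := vertex N -> cell.

Definition set_cell (s : state) (v : vertex N) (c : cell) : state :=
  fun u => if u == v then c else s u.

(* [None] stands for an illegal instruction: rereading an initial tensor, using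
   a tensor that has already been used, or starting before both operands are
   available. *)
Definition execute (s : state) (o : instruction (vertex N)) : option state :=
  match o with
  | Read v start =>
      if s v is Unread then
        let A := tensor_at v in
        Some (set_cell s v (Avail A (start + dim (legs A))))
      else None
  | Mul u v start =>
      match s u, s v with
      | Avail A a, Avail B b =>
          if (u != v) && (maxn a b <= start) then
            Some (set_cell (set_cell s v Consumed) u
                    (Avail (contract A B) (start + matmul_time A B)))
          else None
      | _, _ => None
      end
  end.

Fixpoint run (s : state) (P : seq (instruction (vertex N))) : option state :=
  if P is o :: P' then
    if execute s o is Some s' then run s' P' else None
  else Some s.

(* [P] ends with the single tensor [A]. All the instructions of [P] then
   contribute to [A], so that [t] is the time at which the last one ends. *)
Definition contracts (P : seq (instruction (vertex N))) (A : tensor R N)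
    (t : nat) : Prop :=
  exists (s : state) (v : vertex N),
    [/\ run (fun=> Unread) P = Some s, s v = Avail A t &
        forall u, u != v -> s u = Consumed].

End Algorithm.

Definition degree (X : finType) (adj : rel X) (x : X) : nat :=
  #|[set y | adj x y]|.

Definition is_tree (X : finType) (adj : rel X) : Prop :=
  [/\ symmetric adj, irreflexive adj,
      forall x y, connect adj x y &
      forall c : seq X, cycle adj c -> uniq c -> size c <= 2].

(* [t] is on the simple path from [x] to [y], which is unique in a tree. *)
Definition on_path (X : finType) (adj : rel X) (x y t : X) : Prop :=
  exists p : seq X,
    [/\ path adj x p, last x p = y, uniq (x :: p) & t \in x :: p].

Record contraction_tree (G : weighted_graph) := ContractionTree {
  node : finType;
  adj : rel node;
  adj_tree : is_tree adj;
  tree_root : node;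
  degree_root : degree adj tree_root = 1;
  degree_node : forall t, t != tree_root ->
    degree adj t = 1 \/ degree adj t = 3;
  place : vertex G -> node;
  place_inj : injective place;
  place_codom : forall t,
    (exists v, place v = t) <-> (degree adj t = 1 /\ t <> tree_root) }.

Section Congestion.
Variables (G : weighted_graph) (T : contraction_tree G).

Definition on_routing (e : edge G) (t : node T) : Prop :=
  exists u v : vertex G,
    ends e = [set u; v] /\ on_path (@adj G T) (place T u) (place T v) t.

Definition congestion (t : node T) : nat :=
  \sum_(e : edge G | `[< on_routing e t >]) weight e.

(* The sum includes the root, whose congestion is 0: it contributes 1, the size
   of the final scalar, on top of the readings and the contractions. *)
Definition weighted_height : nat :=
  \max_(l : node T | degree (@adj G T) l == 1)
    \sum_(t : node T | `[< on_path (@adj G T) l (tree_root T) t >])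
      2 ^ congestion t.

End Congestion.

Definition is_minimum (A : nat -> Prop) (m : nat) : Prop :=
  A m /\ forall n, A n -> m <= n.

(* Main.v *)
(* Contraction orders are binary trees [b] whose leaves are the vertices; such a
   tree has an obvious earliest finishing time, and the theorem follows from
   identifying its minimum with both minima of the statement. A legal program
   maintains a forest of such trees, one for each available cell, so it ends no
   earlier than the tree it builds; conversely, a tree can be compiled to a
   program that meets its finishing time. In a contraction tree [T], the edges
   of the graph whose routing contains a vertex [t] of degree 3 are those whose
   endpoints are not in the same component of [T - t]: they are the legs of the
   two tensors contracted at [t], so that [2 ^ congestion t] is the cost of
   this contraction and the weighted height is the finishing time plus 1, the
   weight of the root. *)

From HB Require Import structures.
Require Import Defs.
From mathcomp Require Import all_boot all_order all_algebra.
From mathcomp Require Import boolp reals complex.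

Set Implicit Arguments.
Unset Strict Implicit.
Unset Printing Implicit Defensive.

Import GRing.Theory.

(** * Branches of a tree *)

Section TreeBranches.
Variables (X : finType) (adj : rel X).
Hypothesis adj_tree : is_tree adj.

Let adjC : symmetric adj. Proof. by case: adj_tree. Qed.
Let adj_irr : irreflexive adj. Proof. by case: adj_tree. Qed.

Definition avoiding (p : X) : rel X :=
  fun x y => [&& adj x y, x != p & y != p].

(** For [t] adjacent to [p], this is the component of [t] once [p] is removed: the subtree below [t]
    when [p] is its parent. *)
Definition branch (p t : X) : {set X} := [set s | connect (avoiding p) t s].

Lemma avoiding_path p x s :
  path adj x s -> p \notin x :: s -> path (avoiding p) x s.
Proof.
elim: s x => //= y s IHs x /andP[xy ys].
rewrite !inE !negb_or => /and3P[px py ps].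
by rewrite /avoiding xy ![_ == p]eq_sym px py IHs // inE negb_or py.
Qed.

Lemma path_avoiding p x s :
  path (avoiding p) x s -> path adj x s /\ p \notin s.
Proof.
elim: s x => //= y s IHs x /andP[/and3P[xy xp yp] /IHs[ys ps]].
by rewrite xy ys inE negb_or eq_sym yp.
Qed.

Lemma connect_avoidingC p : connect_sym (avoiding p).
Proof.
by apply: sym_connect_sym => x y /=; rewrite /avoiding adjC [(x != p) && _]andbC.
Qed.

Lemma mem_branch p t : t \in branch p t.
Proof. by rewrite inE. Qed.

Lemma root_notin_branch p t : adj p t -> p \notin branch p t.
Proof.
move=> pt; rewrite inE; apply/connectP => -[s /path_avoiding[_ ps] ep].
case: s ps ep => [_ ep | y s ps ep]; last by rewrite ep /= mem_last in ps.
by rewrite ep adj_irr in pt.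
Qed.

(** A simple path from [a] to [b] that avoids [x] closes up through [x] into a cycle. Acyclicity
    bounds its length by 2, so the path is trivial. *)
Lemma neighbours_separated x a b :
  adj x a -> adj x b -> connect (avoiding x) a b -> a = b.
Proof.
move=> xa xb /connectP[s0 pth eb].
case/shortenP: pth eb => s pths us _ eb; have [ads xs] := path_avoiding pths.
have [_ _ _ acyc] := adj_tree.
have := acyc (x :: a :: s).
rewrite /= rcons_path xa ads /= -eb adjC xb => /(_ isT).
move: us => /= ->; rewrite inE negb_or xs !andbT.
have -> : x != a by apply: contraTneq xa => ->; rewrite adj_irr.
by move=> /(_ isT); case: s {pths ads xs} eb.
Qed.

Lemma branches_disjoint x a b s :
  adj x a -> adj x b -> s \in branch x a -> s \in branch x b -> a = b.
Proof.
move=> xa xb; rewrite !inE => sa sb; apply: (neighbours_separated xa xb).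
by apply: connect_trans sa _; rewrite connect_avoidingC.
Qed.

Lemma branch_cover x s : s != x -> exists2 a, adj x a & s \in branch x a.
Proof.
move=> sx; have [_ _ /(_ x s) /connectP[q0 pth es] _] := adj_tree.
case/shortenP: pth es => -[|a q] pthq /andP[xq uq] _ es.
  by rewrite es eqxx in sx.
move: pthq => /= /andP[xa aq]; exists a => //; rewrite inE.
by apply/connectP; exists q => //; apply: avoiding_path.
Qed.

(** A simple path from [t] off [p] is trivial or enters a child [c] and never returns to [t].
    Conversely, a path from [c] off [t] cannot meet [p], since the neighbours [p] and [c] of [t] lie
    in different branches at [t]. *)
Lemma branchP p t s : adj p t ->
  reflect (s = t \/ exists c, [/\ adj t c, c != p & s \in branch t c])
          (s \in branch p t).
Proof.
move=> pt; apply: (iffP idP) => [|[->|[c [tc cp]]]]; last 2 first.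
- exact: mem_branch.
- move=> sc; rewrite inE; have := sc; rewrite inE => /connectP[q qp es].
  have [aq tq] := path_avoiding qp.
  suff pq: p \notin c :: q.
    apply/connectP; exists (c :: q) => //.
    apply: avoiding_path; first by rewrite /= tc.
    by rewrite in_cons negb_or pq andbT; apply: contraTneq pt => ->;
       rewrite adj_irr.
  apply/negP => /splitPl pq; case: pq es qp => q1 q2 eq1 es.
  rewrite cat_path => /andP[q1p _].
  have pc: p \in branch t c by rewrite inE; apply/connectP; exists q1.
  have := branches_disjoint tc _ pc (mem_branch _ _).
  by rewrite adjC pt => /(_ isT) /eqP; rewrite (negPf cp).
rewrite inE => /connectP[q0 pth es].
case/shortenP: pth es => -[|c q] pthq uq _ es; first by left.
right; exists c; have [+ pq] := path_avoiding pthq.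
move=> /= /andP[tc cq]; split=> //.
  by apply: contraNneq pq => <-; rewrite mem_head.
rewrite inE; apply/connectP; exists q => //.
by apply: avoiding_path => //; case/andP: uq.
Qed.

Lemma branch_sub p t c :
  adj p t -> adj t c -> c != p -> branch t c \proper branch p t.
Proof.
move=> pt tc cp; apply/properP; split.
  by apply/subsetP => s sc; apply/branchP => //; right; exists c.
by exists t; [apply: mem_branch | apply: root_notin_branch].
Qed.

Lemma connect_avoided p y : connect (avoiding p) p y -> p = y.
Proof. by case/connectP => -[|z s] //= /andP[/and3P[_]]; rewrite eqxx. Qed.

(** Separation by [t] replaces any mention of a particular path. An endpoint is isolated in
    [avoiding t], so it separates as soon as [x != y]. At an inner vertex of a simple path, the
    neighbours on either side are distinct, hence in different branches. *)
Lemma on_pathP x y t :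
  x != y -> on_path adj x y t <-> ~~ connect (avoiding t) x y.
Proof.
move=> xy; split=> [[q [qp ey uq tq]] | cxy]; last first.
  have [_ _ /(_ x y) /connectP[q0 pth ey] _] := adj_tree.
  case/shortenP: pth ey => q qp uq _ ey; exists q; split=> //.
  apply: contraNT cxy => tq; apply/connectP; exists q => //.
  exact: avoiding_path.
apply/negP => cxy.
have [etx|tx] := eqVneq t x.
  by move: cxy; rewrite etx => /connect_avoided/eqP; rewrite (negPf xy).
have [ety|ty] := eqVneq t y.
  move: cxy; rewrite ety connect_avoidingC => /connect_avoided/eqP.
  by rewrite eq_sym (negPf xy).
move: tq; rewrite inE (negPf tx) /= => tq.
case/splitPr: tq qp ey uq => q1 [|b q2].
  by rewrite last_cat /= => _ ety; rewrite ety eqxx in ty.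
rewrite cat_path last_cat => /and4P[q1p ta tb q2p] ey.
rewrite -cat_cons cat_uniq => /and3P[_ /hasPn disj /andP[tbq _]].
have xa : connect (avoiding t) x (last x q1).
  apply/connectP; exists q1 => //; apply: avoiding_path => //.
  by apply: disj; rewrite mem_head.
have yb : connect (avoiding t) b y.
  by apply/connectP; exists q2 => //; apply: avoiding_path.
have ab : connect (avoiding t) (last x q1) b.
  rewrite connect_avoidingC in xa; apply: connect_trans xa _.
  by apply: connect_trans cxy _; rewrite connect_avoidingC.
have eab : last x q1 = b by apply: neighbours_separated ab; rewrite // adjC.
have /negP[] : b \notin x :: q1 by apply: disj; rewrite !inE eqxx orbT.
by rewrite -eab mem_last.
Qed.

(** Simple paths are unique: if [q] misses [t], it connects its ends in the tree without [t], and
    then by [on_pathP] no simple path between them passes through [t]. *)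
Lemma on_path_uniq x y q t : path adj x q -> last x q = y -> uniq (x :: q) ->
  on_path adj x y t <-> t \in x :: q.
Proof.
move=> qp ey uq; split=> [|tq]; last by exists q.
have [<-|xy] := eqVneq x y.
  case=> -[|z s] [_ es us]; first by rewrite !inE => ->.
  by move: us; rewrite -{1}es /= mem_last.
move/(on_pathP _ xy); apply: contraR => tq.
by apply/connectP; exists q => //; apply: avoiding_path.
Qed.
End TreeBranches.

(** * Binary trees, programs and tensors *)

Inductive btree (V : Type) := Leaf of V | Node of btree V & btree V.

Arguments Leaf {V} v.

Fixpoint leaves (V : Type) (b : btree V) : seq V :=
  match b with Leaf v => [:: v] | Node l r => leaves l ++ leaves r end.

(** This names the cell that receives the tensor of [b], since [Mul] stores its result in the cell
    of its first operand. *)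
Fixpoint first_leaf (V : Type) (b : btree V) : V :=
  match b with Leaf v => v | Node l _ => first_leaf l end.

Lemma first_leaf_in (V : eqType) (b : btree V) : first_leaf b \in leaves b.
Proof. by elim: b => [v|l IHl r _] /=; rewrite ?mem_head // mem_cat IHl. Qed.

Definition spanning (V : finType) (b : btree V) : Prop :=
  uniq (leaves b) /\ forall v, v \in leaves b.

Lemma exists_spanning (V : finType) : 0 < #|V| -> exists b : btree V, spanning b.
Proof.
rewrite cardE => V_gt0.
suff [b eb] : exists b : btree V, leaves b = enum V.
  by exists b; rewrite /spanning eb enum_uniq; split=> // v; rewrite mem_enum.
elim: (enum V) V_gt0 => // v [_ _|w s IHs _]; first by exists (Leaf v).
by have [b eb] := IHs isT; exists (Node (Leaf v) b); rewrite /= eb.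
Qed.

Lemma uniq_leavesN (V : eqType) (l r : btree V) :
  uniq (leaves (Node l r)) ->
  [/\ uniq (leaves l), uniq (leaves r) &
      forall v, ~~ ((v \in leaves l) && (v \in leaves r))].
Proof.
rewrite /= cat_uniq => /and3P[ul /hasPn lr ur]; split=> // v.
by rewrite andbC; apply/negP => /andP[/lr/negP].
Qed.

Lemma ends_pair (G : weighted_graph) (e : edge G) :
  exists u v, u != v /\ ends e = [set u; v].
Proof. by have /eqP/cards2P[u [v [uv ->]]] := card_ends e; exists u, v. Qed.

(** * Partial sums over some of the indices *)

Section Marginals.
Variables (R : realType) (G : weighted_graph).
Implicit Types (S T : {set edge G}) (x y z : assignment G).
Implicit Types F H : assignment G -> R[i].

(** [contract_entry] has this form, with the shared indices as [S], so nested contractions become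
    iterated marginals. *)
Definition marginal S F x : R[i] := (\sum_(z | agree_off S x z) F z)%R.

Lemma agree_offP S x z :
  reflect (forall e, e \notin S -> z e = x e) (agree_off S x z).
Proof.
apply: (iffP forallP) => xz e; last by apply/implyP => /xz ->.
by move=> eS; have := xz e; rewrite eS => /eqP.
Qed.

Lemma eq_marginal S F H x :
  (forall z, F z = H z) -> marginal S F x = marginal S H x.
Proof. by move=> FH; apply: eq_bigr. Qed.

Lemma marginal0 F x : marginal set0 F x = F x.
Proof.
rewrite /marginal (big_pred1 x) // => z; apply/agree_offP/eqP => [xz|-> //].
by apply/ffunP => e; rewrite xz // inE.
Qed.

Lemma marginalT F x : marginal setT F x = (\sum_z F z)%R.
Proof. by apply: eq_bigl => z; apply/agree_offP => e; rewrite inE. Qed.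

Lemma marginalMl S H F x :
  (forall z, agree_off S x z -> H z = H x) ->
  marginal S (fun z => H z * F z)%R x = (H x * marginal S F x)%R.
Proof. by move=> Hx; rewrite mulr_sumr; apply: eq_bigr => z /Hx ->. Qed.

(** After the two sums are exchanged, each [y] is reached through a single intermediate assignment,
    the one that follows [y] on [S] and [x] elsewhere. *)
Lemma marginal_marginal S T F x : [disjoint S & T] ->
  marginal S (marginal T F) x = marginal (S :|: T) F x.
Proof.
move=> ST; rewrite /marginal.
rewrite (exchange_big_dep (agree_off (S :|: T) x)) /= => [|z y]; last first.
  move=> /agree_offP xz /agree_offP zy; apply/agree_offP => e.
  by rewrite inE negb_or => /andP[eS eT]; rewrite zy // xz.
apply: eq_bigr => y /agree_offP xy.
pose m : assignment G := [ffun e => if e \in S then y e else x e].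
rewrite (big_pred1 m) // => z /=; apply/andP/eqP => [[/agree_offP xz /agree_offP zy]|->].
  apply/ffunP => e; rewrite ffunE; case: ifPn => eS; last exact: xz.
  by rewrite zy // (disjointFr ST).
split; apply/agree_offP => e eS; rewrite ffunE; first by rewrite (negPf eS).
by case: ifPn => // eS'; rewrite xy // inE negb_or eS'.
Qed.

End Marginals.

(** * Value and cost of a contraction order *)

Section TreePrograms.
Variables (R : realType) (N : tensor_network R).
Implicit Types (b l r : btree (vertex N)) (x y z : assignment N).

Fixpoint tree_tensor b : tensor R N :=
  match b with
  | Leaf v => tensor_at v
  | Node l r => contract (tree_tensor l) (tree_tensor r)
  end.

Fixpoint finish_time b : nat :=
  match b with
  | Leaf v => Defs.dim (legs (tensor_at v))
  | Node l r => maxn (finish_time l) (finish_time r) +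
                matmul_time (tree_tensor l) (tree_tensor r)
  end.

(** Contraction takes the symmetric difference of the legs, and the edge cut around a union of
    disjoint vertex sets is the symmetric difference of their cuts. For one vertex, the cut is its
    set of incident edges. *)
Lemma legs_tree_tensor b e u v :
  uniq (leaves b) -> u != v -> ends e = [set u; v] ->
  (e \in legs (tree_tensor b)) = (u \in leaves b) (+) (v \in leaves b).
Proof.
move=> + uv ee; elim: b => [w _|l IHl r IHr /uniq_leavesN[ul ur lr]] /=.
  rewrite legs_tensor_at !inE ee !inE ![w == _]eq_sym.
  by have [<-|] := eqVneq u w; rewrite ?[v == u]eq_sym ?(negPf uv).
rewrite !inE !mem_cat IHl // IHr //; move: (lr u) (lr v).
by case: (u \in leaves l) (u \in leaves r) (v \in leaves l) (v \in leaves r)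
  => [] [] [] [].
Qed.

(** These are the indices already summed when the tensor of [b] is complete. *)
Definition inner_edges b : {set edge N} := 
  [set e | ends e \subset [set v in leaves b]].

Lemma inner_edgesE b e u v : ends e = [set u; v] ->
  (e \in inner_edges b) = (u \in leaves b) && (v \in leaves b).
Proof. by move=> ee; rewrite inE ee subUset !sub1set !inE. Qed.

(** These facts split the sum in [tree_tensorE] and move its factors. The equality and the
    disjointness claims depend only on which leaf sets contain the two endpoints of an edge, hence
    the boolean case analysis. *)
Lemma inner_edgesN l r : uniq (leaves (Node l r)) ->
  [/\ inner_edges (Node l r) =
        (legs (tree_tensor l) :&: legs (tree_tensor r)) :|:
        (inner_edges l :|: inner_edges r),
      [disjoint legs (tree_tensor l) :&: legs (tree_tensor r)
         & inner_edges l :|: inner_edges r],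
      [disjoint inner_edges l & inner_edges r],
      [disjoint legs (tree_tensor r) & inner_edges l] &
      forall v e, v \in leaves l -> e \in incident v -> e \notin inner_edges r].
Proof.
move=> /uniq_leavesN[ul ur lr].
have setE (A B : {set edge N}) :
    (forall e u v, u != v -> ends e = [set u; v] -> (e \in A) = (e \in B)) ->
    A = B.
  by move=> AB; apply/setP => e; have [u [v [uv /(AB e u v uv)]]] := ends_pair e.
split.
5: move=> v e vl; rewrite inE => ve; rewrite inE; apply/negP => /subsetP/(_ _ ve).
5: by have := lr v; rewrite vl inE => /negP.
2-4: rewrite -setI_eq0; apply/eqP.
all: apply: setE => e u v uv ee.
all: rewrite !(in_setI, in_setU, in_set0).
all: rewrite ?(legs_tree_tensor _ uv ee) // ?(inner_edgesE _ ee) ?mem_cat.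
all: move: (lr u) (lr v).
all: by case: (u \in leaves l) (u \in leaves r) (v \in leaves l)
  (v \in leaves r) => [] [] [] [].
Qed.

(** By distributivity, a factor moves under the sums over indices on which it does not depend, so
    that nested contractions flatten to one sum. *)
Lemma tree_tensorE b x : uniq (leaves b) ->
  entry (tree_tensor b) x =
  marginal (inner_edges b)
    (fun z => \prod_(v <- leaves b) entry (tensor_at v) z)%R x.
Proof.
elim: b x => [v x _|l IHl r IHr x ub].
  rewrite (_ : inner_edges _ = set0) ?marginal0 ?big_seq1 //.
  apply/setP => e; have [u [w [uw ee]]] := ends_pair e.
  rewrite (inner_edgesE _ ee) !inE.
  by apply: contraNF uw => /andP[/eqP-> /eqP->].
have [ul ur _] := uniq_leavesN ub; have [-> dS dlr dI out] := inner_edgesN ub.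
rewrite -marginal_marginal //; apply: eq_marginal => z.
rewrite IHl // -marginal_marginal // mulrC.
(* The tensor of [r] has no leg among the inner edges of [l], so it enters the sum over them. Next,
   the tensors at the leaves of [l] enter the sum over the inner edges of [r] in the same way. *)
rewrite -(marginalMl (H := entry (tree_tensor r))) => [|y /agree_offP zy].
  apply: eq_marginal => y; rewrite IHr // mulrC.
  rewrite -(marginalMl (H := fun z => \prod_(v <- leaves l) entry (tensor_at v) z)%R).
    by apply: eq_marginal => w; rewrite /= big_cat.
  move=> w /agree_offP yw; apply: eq_big_seq => v vl.
  apply: entry_local => e; rewrite legs_tensor_at => ev.
  exact: yw (out v e vl ev).
apply: entry_local => e er; apply: zy.
by rewrite (disjointFr dI er).
Qed.

(** When the leaves are all the vertices, no edge leaves them and every index has been summed. This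
    is the correctness of every contraction order. *)
Lemma tree_tensor_value b : spanning b ->
  legs (tree_tensor b) = set0 /\
  forall x, entry (tree_tensor b) x = network_value N.
Proof.
move=> [ub allb]; split=> [|x].
  apply/setP => e; have [u [v [uv ee]]] := ends_pair e.
  by rewrite (legs_tree_tensor ub uv ee) !allb inE.
rewrite tree_tensorE // (_ : inner_edges b = setT).
  rewrite marginalT; apply: eq_bigr => z _.
  rewrite big_uniq //=; apply: eq_bigl => v; exact: allb.
by apply/setP => e; rewrite !inE; apply/subsetP => v _; rewrite inE.
Qed.

(** * Programs and contraction orders *)

Fixpoint tree_program b : seq (instruction (vertex N)) :=
  match b with
  | Leaf v => [:: Read v 0]
  | Node l r => tree_program l ++ tree_program r ++
      [:: Mul (first_leaf l) (first_leaf r)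
            (maxn (finish_time l) (finish_time r))]
  end.

Lemma run_cat (s : state N) P Q :
  run s (P ++ Q) = if run s P is Some s' then run s' Q else None.
Proof. by elim: P s => //= o P IHP s; case: (execute s o). Qed.

(** The start state is arbitrary outside the leaves of [b], and the last clause says that those
    other cells are untouched; thus the code of [r] runs after that of [l] without interference. The
    starting times of [r] begin again at 0, so the two sides overlap in time although their
    instructions are listed one after the other. *)
Lemma run_tree_program b (s : state N) : uniq (leaves b) ->
  (forall v, v \in leaves b -> s v = Unread _) ->
  exists s' : state N,
    [/\ run s (tree_program b) = Some s',
        s' (first_leaf b) = Avail (tree_tensor b) (finish_time b),
        forall v, v \in leaves b -> v != first_leaf b -> s' v = Consumed _ &
        forall v, v \notin leaves b -> s' v = s v].
Proof.
elim: b s => [v s _ sv|l IHl r IHr s ub sb] /=.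
  rewrite sv ?inE //; eexists; split; [by []|..]; rewrite /set_cell.
  - by rewrite eqxx.
  - by move=> u; rewrite inE => ->.
  - by move=> u; rewrite inE => /negPf ->.
have [ul ur lr] := uniq_leavesN ub.
have [|s1 [run1 val1 used1 out1]] := IHl s ul.
  by move=> v vl; apply: sb; rewrite /= mem_cat vl.
have [|s2 [run2 val2 used2 out2]] := IHr s1 ur.
  move=> v vr; have := lr v; rewrite vr andbT => vl.
  by rewrite out1 // sb //= mem_cat vr orbT.
have := lr (first_leaf l); rewrite first_leaf_in /= => fl.
have fneq : first_leaf l != first_leaf r.
  by apply: contraNneq fl => ->; apply: first_leaf_in.
rewrite !run_cat run1 run_cat run2 /= out2 // val1 val2 fneq leqnn /=.
eexists; split; [by []|..]; rewrite /set_cell.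
- by rewrite eqxx.
- move=> v; rewrite mem_cat => vlr /negPf vl; rewrite vl.
  case: eqVneq => // vr; have [inr|notinr] := boolP (v \in leaves r).
    exact: used2.
  rewrite out2 //; apply: used1; last by rewrite vl.
  by rewrite (negPf notinr) orbF in vlr.
- move=> v; rewrite mem_cat negb_or => /andP[vl vr].
  rewrite !ifN ?out2 ?out1 //; first by apply: contraNneq vr => ->; apply: first_leaf_in.
  by apply: contraNneq vl => ->; apply: first_leaf_in.
Qed.

Lemma contracts_tree_program b : spanning b ->
  contracts (tree_program b) (tree_tensor b) (finish_time b).
Proof.
move=> [ub allb].
have [//|s [run_b val used _]] := run_tree_program (s := fun=> Unread _) ub.
by exists s, (first_leaf b); split=> // u; apply: used; apply: allb.
Qed.

(* Every available cell [u] holds the tensor of a contraction tree [f u], and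
   the leaves of these trees partition the vertices read so far. *)
Definition forest_state (s : state N) (f : vertex N -> btree (vertex N)) : Prop :=
  [/\ forall u A t, s u = Avail A t ->
        [/\ uniq (leaves (f u)), A = tree_tensor (f u),
            finish_time (f u) <= t &
            forall v, v \in leaves (f u) -> s v <> Unread _],
      forall u A t u' A' t' v, s u = Avail A t -> s u' = Avail A' t' ->
        v \in leaves (f u) -> v \in leaves (f u') -> u = u' &
      forall v, s v <> Unread _ ->
        exists u A t, s u = Avail A t /\ v \in leaves (f u)].

(** [Read] adds a one-leaf tree; [Mul] joins the trees of its operands under a new node. A legal
    product starts when both operands are complete or later, so it ends no earlier than the
    finishing time of the joined tree. *)
Lemma execute_forest s f o s' : forest_state s f -> execute s o = Some s' ->
  exists f', forest_state s' f'.
Proof.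
move=> [fs disj cov]; case: o => [w st|p q st] /=.
  case ew: (s w) => // -[<-].
  exists (fun u => if u == w then Leaf w else f u).
  have notw u A t : s u = Avail A t -> w \notin leaves (f u).
    by move=> su; apply/negP => wu; have [_ _ _ /(_ w wu)/(_ ew)] := fs u A t su.
  split.
  - move=> u A t; rewrite /set_cell; case: eqVneq => [_ [<- <-]|uw su].
      split=> //=; first exact: leq_addl.
      by move=> v; rewrite inE => ->.
    have [? ? ? rd] := fs _ _ _ su; split=> // v vu.
    by case: ifP => // _; apply: rd.
  - move=> u A t u' A' t' v; rewrite /set_cell.
    case: eqVneq => [->|uw] su; case: eqVneq => [->|u'w] su' //=.
    + by rewrite inE => /eqP ->; rewrite (negPf (notw _ _ _ su')).
    + by move=> + /[!inE] /eqP ev; rewrite ev (negPf (notw _ _ _ su)).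
    + exact: disj su su'.
  - move=> v; rewrite /set_cell; case: eqVneq => [-> _|vw /cov[u [A [t [su vu]]]]].
      by exists w; do 2!eexists; rewrite eqxx; split; [by []|rewrite inE].
    exists u, A, t; have [euw|//] := eqVneq u w.
    by rewrite euw ew in su.
case sp: (s p) => [|A a|] //; case sq: (s q) => [|B b|] //.
case: ifP => // /andP[pq st_ge] [<-].
have [up Ap ap rdp] := fs _ _ _ sp; have [uq Bq bq rdq] := fs _ _ _ sq.
exists (fun u => if u == p then Node (f p) (f q) else f u); split.
- move=> u C t; rewrite /set_cell; case: eqVneq => [_ [<- <-]|u_p].
    split.
    + rewrite /= cat_uniq up uq andbT; apply/hasPn => v vq.
      apply/negP => vp; have := disj _ _ _ _ _ _ _ sp sq vp vq.
      by apply/eqP.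
    + by rewrite Ap Bq.
    + rewrite /= Ap Bq leq_add2r; apply: leq_trans st_ge.
      by rewrite geq_max !leq_max ap bq orbT.
    + move=> v; rewrite /= mem_cat => /orP[/rdp|/rdq];
        by do 2!case: ifP => // _.
  case: eqVneq => // u_q su; have [? ? ? rd] := fs _ _ _ su; split=> // v /rd.
  by do 2!case: ifP => // _.
- have disjN u C t v : u != p -> u != q -> s u = Avail C t ->
      v \in leaves (f u) -> v \in leaves (Node (f p) (f q)) -> False.
    move=> u_p u_q su vu; rewrite /= mem_cat => /orP[] vpq.
      by move: u_p; rewrite (disj _ _ _ _ _ _ _ su sp vu vpq) eqxx.
    by move: u_q; rewrite (disj _ _ _ _ _ _ _ su sq vu vpq) eqxx.
  move=> u C t u' C' t' v; rewrite /set_cell.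
  case: (eqVneq u p) => [->|u_p]; case: (eqVneq u' p) => [->|u'_p] //.
  + case: (eqVneq u' q) => // u'_q _ su' vpq vu'.
    by case: (disjN u' C' t' v).
  + case: (eqVneq u q) => // u_q su _ vu vpq.
    by case: (disjN u C t v).
  + case: (eqVneq u q) => // u_q; case: (eqVneq u' q) => // u'_q.
    exact: disj.
- move=> v; rewrite /set_cell => nv.
  have [u [C [t [su vu]]]] : exists u C t, s u = Avail C t /\ v \in leaves (f u).
    apply: cov => sv; move: nv; rewrite sv.
    by case: eqVneq sv => [->|_]; [rewrite sp|case: eqVneq => [->|//]; rewrite sq].
  have [u_pq|] := boolP ((u == p) || (u == q)).
    exists p; do 2!eexists; rewrite eqxx; split; first by [].
    by rewrite /= mem_cat; case/orP: u_pq => /eqP <-; rewrite vu ?orbT.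
  rewrite negb_or => /andP[/negPf u_p /negPf u_q].
  by exists u, C, t; rewrite u_p u_q.
Qed.

Lemma run_forest s f P s' : forest_state s f -> run s P = Some s' ->
  exists f', forest_state s' f'.
Proof.
elim: P s f => [|o P IHP] s f fs /=; first by case=> <-; exists f.
case eo: (execute s o) => [s1|//] /IHP.
by have [f1 fs1] := execute_forest fs eo; apply; apply: fs1.
Qed.

(** At the end no cell is unread and only one is available, so its tree must have every vertex as a
    leaf. *)
Lemma contracts_spanning P (A : tensor R N) t : contracts P A t ->
  exists2 b, spanning b & finish_time b <= t.
Proof.
move=> [s [v [runP sv used]]].
(* No cell is available at the start, so the initial family of trees is a placeholder. *)
have [|f [fs _ cov]] := run_forest (f := Leaf) _ runP; first by split.
have [uv _ ft _] := fs _ _ _ sv; exists (f v) => //; split=> // u.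
have [|w [B [t' [sw uw]]]] := cov u.
  by have [->|/used ->] := eqVneq u v; rewrite ?sv.
by have [<- //|/used] := eqVneq w v; rewrite sw.
Qed.

End TreePrograms.

(** * From contraction trees to binary trees *)

Lemma dimE (G : weighted_graph) (S : {set edge G}) :
  Defs.dim S = 2 ^ \sum_(e in S) weight e.
Proof. by rewrite /Defs.dim -expn_sum. Qed.

(** The three index groups partition the union of the legs. *)
Lemma matmul_timeE (R : realType) (G : weighted_graph) (A B : tensor R G) :
  matmul_time A B = Defs.dim (legs A :|: legs B).
Proof.
rewrite /matmul_time !dimE -!expnD; congr (2 ^ _).
rewrite [in RHS](big_setID (legs A)) /= setUK setDUl setDv set0U.
by rewrite [in RHS](big_setID (A := legs A) (legs B)) /= [X in X + _ = _]addnC.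
Qed.

Lemma cards1E (X : finType) (A : {set X}) x :
  #|A| = 1 -> x \in A -> A = [set x].
Proof. by move=> /eqP/cards1P[y ->]; rewrite inE => /eqP ->. Qed.

Section Unfolding.
Variables (R : realType) (N : tensor_network R) (T : contraction_tree N).
Implicit Types (p t : node T) (b l r : btree (vertex N)).

Local Notation adj := (@adj N T).
Local Notation place := (place T).

(** The branch at [t], seen from its parent [p], is read as a binary tree. This is a relation
    because the two children of a node come in no order: exchanging [c] and [d] gives another
    unfolding. *)
Inductive unfolds : node T -> node T -> btree (vertex N) -> Prop :=
| UnfoldsLeaf p v : adj (place v) =1 pred1 p -> unfolds p (place v) (Leaf v)
| UnfoldsNode p t c d l r :
    uniq [:: p; c; d] -> (forall s, adj t s = (s \in [:: p; c; d])) ->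
    unfolds t c l -> unfolds t d r -> unfolds p t (Node l r).

Let adjC : symmetric adj. Proof. by case: (adj_tree T). Qed.

Lemma unfolds_adj p t b : unfolds p t b -> adj p t.
Proof.
by case=> [{}p v pv | {}p {}t c d l r _ pt _ _]; rewrite adjC ?pv /= ?pt ?mem_head.
Qed.

Lemma place_neq_root v : place v != tree_root T.
Proof.
by apply/eqP => e; have [[]] := place_codom (place v); first by exists v.
Qed.

Lemma place_degree v : degree adj (place v) = 1.
Proof. by have [[]] := place_codom (place v); first by exists v. Qed.

Lemma place_adj v p : adj (place v) p -> adj (place v) =1 pred1 p.
Proof.
move=> vp s; have pv : p \in [set y | adj (place v) y] by rewrite inE.
by have /setP/(_ s) := cards1E (place_degree v) pv; rewrite !inE.
Qed.

Lemma place_neq v t c d s : uniq [:: c; d; s] ->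
  (forall x, adj t x = (x \in [:: c; d; s])) -> place v != t.
Proof.
move=> u3 ts; apply/eqP => ev; have := place_degree v.
rewrite ev /degree (eq_card (B := mem [:: c; d; s])) => [|x].
  by rewrite (card_uniqP u3).
by rewrite inE ts.
Qed.

(** Induction on the size of the branch. The root lies outside it, so each of its nodes is the place
    of a vertex or has degree 3, that is, one parent and two children. *)
Lemma exists_unfolds p t : adj p t -> tree_root T \notin branch adj p t ->
  exists b, unfolds p t b.
Proof.
have [n] := ubnP #|branch adj p t|; elim: n p t => // n IHn p t ltn pt rt.
have tr : t != tree_root T by apply: contraNneq rt => <-; apply: mem_branch.
have tp : p \in [set x | adj t x] by rewrite inE adjC.
have [d1|d3] := degree_node tr.
  have /place_codom [v ev] : degree adj t = 1 /\ t <> tree_root T.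
    by split=> //; apply/eqP.
  exists (Leaf v); rewrite -ev; constructor; apply: place_adj.
  by rewrite ev adjC.
have := cardsD1 p [set x | adj t x]; rewrite tp.
rewrite -[#|[set x | _]|]/(degree adj t) d3 => -[/esym/eqP/cards2P[c [d [cd ecd]]]].
have tE s : adj t s = (s \in [:: p; c; d]).
  have /setP/(_ s) := ecd; rewrite !inE.
  by have [->|] := eqVneq s p; rewrite //= adjC.
have /setP/(_ c) := ecd; rewrite !inE eqxx /= => /andP[cp tc].
have /setP/(_ d) := ecd; rewrite !inE eqxx orbT /= => /andP[dp td].
have smaller s : adj t s -> s != p -> exists b, unfolds t s b.
  move=> ts sp; have sub := branch_sub (adj_tree T) pt ts sp.
  apply: IHn => //; first by apply: leq_trans (proper_card sub) _.
  by apply: contra rt; apply: (subsetP (proper_sub sub)).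
have [l sl] := smaller c tc cp; have [r sr] := smaller d td dp.
exists (Node l r); apply: (UnfoldsNode _ tE sl sr).
by rewrite /= !inE negb_or ![p == _]eq_sym cp dp cd.
Qed.

Lemma mem_leaves p t b : unfolds p t b ->
  forall v, (v \in leaves b) = (place v \in branch adj p t).
Proof.
elim=> {p t b} [p w wp v|p t c d l r u3 tE sl IHl sr IHr v] /=.
  have pw : adj p (place w) by rewrite adjC wp /=.
  rewrite inE; apply/eqP/(branchP (adj_tree T) _ pw) => [->|]; first by left.
  case=> [/place_inj //|[c [wc cp _]]].
  by move: wc; rewrite wp /= (negPf cp).
have pt : adj p t by rewrite adjC tE mem_head.
rewrite mem_cat IHl IHr; apply/orP/(branchP (adj_tree T) _ pt) => [vs|].
  move: u3; rewrite /= !inE negb_or ![p == _]eq_sym => /and3P[/andP[cp dp] cd _].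
  by case: vs => vs; right; [exists c|exists d]; split=> //;
    rewrite tE !inE eqxx ?orbT.
case=> [/eqP|[s [ts sp vs]]]; first by rewrite (negPf (place_neq v u3 tE)).
by move: ts vs; rewrite tE !inE (negPf sp) /= => /orP[] /eqP ->; [left|right].
Qed.

Lemma unfolds_uniq p t b : unfolds p t b -> uniq (leaves b).
Proof.
elim=> {p t b} [//|p t c d l r u3 tE sl ul sr ur] /=.
rewrite cat_uniq ul ur andbT; apply/hasPn => v.
rewrite /= (mem_leaves sr) (mem_leaves sl) => vd; apply/negP => vc.
have := branches_disjoint (adj_tree T) _ _ vc vd.
rewrite !tE !inE !eqxx !orbT => /(_ isT isT) ecd.
by move: u3; rewrite ecd /= !inE eqxx andbF.
Qed.

(** Distinct endpoints have distinct places, so [on_pathP] applies. [on_routing] may name the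
    endpoints in either order, and the symmetry of [connect] absorbs the choice. *)
Lemma on_routingP e u v t : u != v -> ends e = [set u; v] ->
  `[< on_routing e t >] = ~~ connect (avoiding adj t) (place u) (place v).
Proof.
move=> uv ee; have places x y : x != y -> place x != place y.
  by apply: contraNneq => /place_inj ->.
apply/asboolP/idP => [[u' [v' [ee']]]|uvt]; last first.
  by exists u, v; split=> //; apply/on_pathP; rewrite ?places //; exact: adj_tree.
have u'v' : u' != v' by have := card_ends e; rewrite ee' cards2; case: eqP.
move/on_pathP => /(_ (adj_tree T) (places _ _ u'v')).
have : u' \in [set u; v] by rewrite -ee ee' !inE eqxx.
have : v' \in [set u; v] by rewrite -ee ee' !inE eqxx orbT.
rewrite !inE => /orP[] /eqP ev /orP[] /eqP eu; move: u'v'; rewrite {}ev {}eu ?eqxx //.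
by rewrite connect_avoidingC; [|exact: adj_tree].
Qed.

(** * Congestion of a node as the cost of its operation *)

Lemma connect_branch t a x y : x \in branch adj t a ->
  connect (avoiding adj t) x y = (y \in branch adj t a).
Proof.
rewrite !inE => ax; apply/idP/idP => [|ay]; first exact: connect_trans.
by apply: connect_trans ay; rewrite connect_avoidingC //; exact: adj_tree.
Qed.

(** The node [place v] has one neighbour, so all other places share a branch there; only the edges
    that end at [v] are separated. *)
Lemma congestion_leaf p v : unfolds p (place v) (Leaf v) ->
  2 ^ congestion (place v) = Defs.dim (legs (tensor_at v)).
Proof.
move=> sh; have pv := unfolds_adj sh.
have vp : adj (place v) =1 pred1 p by apply: place_adj; rewrite adjC.
rewrite dimE; congr (2 ^ _); apply: eq_bigl => e.
have [u [w [uw ee]]] := ends_pair e.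
rewrite (on_routingP _ uw ee) legs_tensor_at inE ee !inE.
have [->|vu] := eqVneq v u.
  by apply/negP => /connect_avoided/place_inj/eqP; rewrite (negPf uw).
have [->|vw] := eqVneq v w.
  apply/negP; rewrite connect_avoidingC; last exact: adj_tree.
  by move=> /connect_avoided/place_inj/esym/eqP; rewrite (negPf uw).
have inp x : v != x -> place x \in branch adj (place v) p.
  move=> vx; have [|a va] := branch_cover (adj_tree T) (x := place v) (s := place x).
    by apply: contraNneq vx => /place_inj ->.
  by move: va; rewrite vp /= => /eqP ->.
by rewrite (connect_branch _ (inp u vu)) inp.
Qed.

(** The three branches at [t] hold the leaves of [l], the leaves of [r] and the remaining vertices.
    Two endpoints lie in different branches exactly when the edge is in the cut around the first set
    or around the second. *)
Lemma congestion_node p t l r : unfolds p t (Node l r) ->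
  2 ^ congestion t = matmul_time (tree_tensor l) (tree_tensor r).
Proof.
move=> sh; have /uniq_leavesN[ul ur lr] := unfolds_uniq sh.
inversion sh as [|p' t' c d l' r' u3 tE sl sr]; subst.
rewrite matmul_timeE dimE; congr (2 ^ _); apply: eq_bigl => e.
have [u [v [uv ee]]] := ends_pair e.
rewrite (on_routingP _ uv ee) inE !(legs_tree_tensor _ uv ee) //.
have outE w : (place w \in branch adj t p) = ~~ (w \in leaves l) && ~~ (w \in leaves r).
  rewrite (mem_leaves sl) (mem_leaves sr).
  have [a ta wa] := branch_cover (adj_tree T) (place_neq w u3 tE).
  have tp : adj t p by rewrite tE mem_head.
  have tc : adj t c by rewrite tE !inE eqxx orbT.
  have td : adj t d by rewrite tE !inE eqxx !orbT.
  have inE' s : adj t s -> (place w \in branch adj t s) = (a == s).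
    move=> ts; apply/idP/eqP => [|<- //].
    exact: (branches_disjoint (adj_tree T) ta ts wa).
  rewrite !inE' //; move: ta u3; rewrite tE /= !inE negb_or.
  by move=> /or3P[] /eqP ->; rewrite eqxx => /and3P[/andP[pc pd] cd _];
    rewrite /= ?pc ?pd ?andbF // eq_sym ?(negPf pc) ?(negPf pd).
have [ul1|ul0] := boolP (u \in leaves l).
  have := ul1; rewrite (mem_leaves sl) => /connect_branch ->.
  rewrite -(mem_leaves sl); move: (lr u) (lr v); rewrite ul1.
  by case: (u \in leaves r) (v \in leaves l) (v \in leaves r) => [] [] [].
have [ur1|ur0] := boolP (u \in leaves r).
  have := ur1; rewrite (mem_leaves sr) => /connect_branch ->.
  rewrite -(mem_leaves sr); move: (lr v).
  by case: (v \in leaves l) (v \in leaves r) => [] [].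
have : place u \in branch adj t p by rewrite outE ul0 ur0.
move=> /connect_branch ->; rewrite outE; move: (lr v).
by case: (v \in leaves l) (v \in leaves r) => [] [].
Qed.

(** * Costs of upward paths and the weighted height *)

Definition path_cost p t v (k : nat) : Prop :=
  exists q, [/\ path adj (place v) q, last (place v) q = t,
    uniq (place v :: q), {subset place v :: q <= branch adj p t} &
    \sum_(s <- place v :: q) 2 ^ congestion s = k].

(** The path is confined to the branch at [c], which does not contain [t]; so it stays simple when
    [t] is appended. *)
Lemma path_costN p t c v k : adj p t -> adj t c -> c != p ->
  path_cost t c v k -> path_cost p t v (k + 2 ^ congestion t).
Proof.
move=> pt tc cp [q [qp lq uq sq <-]]; have sub := branch_sub (adj_tree T) pt tc cp.
exists (rcons q t); split.
- by rewrite rcons_path qp lq adjC.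
- by rewrite last_rcons.
- rewrite -rcons_cons rcons_uniq uq andbT.
  by apply/negP => /sq; apply/negP/root_notin_branch => //; exact: adj_tree.
- move=> s; rewrite -rcons_cons mem_rcons in_cons => /predU1P[->|/sq].
    exact: mem_branch.
  exact: (subsetP (proper_sub sub)).
- by rewrite -rcons_cons big_rcons.
Qed.

(** A node lengthens every path from below by the same cost, so the maximum over the leaves follows
    the recursion of [finish_time]. The first half bounds each path; the second exhibits a critical
    one, taken from the slower side. *)
Lemma unfolds_cost p t b : unfolds p t b ->
  (forall v, v \in leaves b -> exists2 k, path_cost p t v k & k <= finish_time b)
  /\ exists2 v, v \in leaves b & path_cost p t v (finish_time b).
Proof.
elim=> {p t b} [p w wp|p t c d l r u3 tE sl [lel [vl vlP geql]] sr [ler [vr vrP geqr]]].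
  have cost : path_cost p (place w) w (finish_time (Leaf w)).
    exists [::]; split=> //; first by move=> s; rewrite inE => /eqP ->; apply: mem_branch.
    by rewrite big_seq1; apply: (congestion_leaf (UnfoldsLeaf wp)).
  split=> [v|]; last by exists w; rewrite ?inE.
  by rewrite inE => /eqP ->; eexists; [apply: cost|].
have pt : adj p t by rewrite adjC tE mem_head.
have con := congestion_node (UnfoldsNode u3 tE sl sr).
move: u3; rewrite /= !inE negb_or ![p == _]eq_sym => /and3P[/andP[cp dp] cd _].
have tc : adj t c by rewrite tE !inE eqxx orbT.
have td : adj t d by rewrite tE !inE eqxx !orbT.
rewrite /= -con; split=> [v|].
  rewrite mem_cat => /orP[/lel|/ler] [k kP lek].
    by exists (k + 2 ^ congestion t); [apply: path_costN kP|
       rewrite leq_add2r leq_max lek].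
  by exists (k + 2 ^ congestion t); [apply: path_costN kP|
     rewrite leq_add2r leq_max lek orbT].
have [_|_] := leqP (finish_time l) (finish_time r).
  exists vr; first by rewrite mem_cat vrP orbT.
  by apply: path_costN geqr.
exists vl; first by rewrite mem_cat vlP.
by apply: path_costN geql.
Qed.

Lemma root_branch p t s : adj p =1 pred1 t -> (s \in branch adj p t) = (s != p).
Proof.
move=> pE; have pt : adj p t by rewrite pE /=.
apply/idP/idP => [|sp].
  by apply: contraTneq => ->; apply: root_notin_branch => //; exact: adj_tree.
by have [a] := branch_cover (adj_tree T) sp; rewrite pE => /eqP ->.
Qed.

(** All places lie in the single branch at the root, so removing the root separates no edge. *)
Lemma congestion_root t : adj (tree_root T) =1 pred1 t ->
  congestion (tree_root T) = 0.
Proof.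
move=> rE; apply: big_pred0 => e; have [u [v [uv ee]]] := ends_pair e.
have rt w : place w \in branch adj (tree_root T) t.
  by rewrite root_branch // place_neq_root.
by rewrite (on_routingP _ uv ee) (connect_branch _ (rt u)) rt.
Qed.

(** Each path from a place to the root is a path within the branch below the root followed by the
    root itself, whose weight [2 ^ 0] is the successor. *)
Lemma weighted_height_unfolds t b : adj (tree_root T) =1 pred1 t ->
  unfolds (tree_root T) t b -> weighted_height T = (finish_time b).+1.
Proof.
move=> rE sh; have rt := unfolds_adj sh; have [le_ft [v0 _ cost0]] := unfolds_cost sh.
have con0 := congestion_root rE.
have costE v k : path_cost (tree_root T) t v k ->
    \sum_(s : node T | `[< on_path adj (place v) (tree_root T) s >])
      2 ^ congestion s = k.+1.
  move=> [q [qp lq uq sq <-]].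
  have uqr : uniq (rcons (place v :: q) (tree_root T)).
    rewrite rcons_uniq uq andbT; apply/negP => /sq.
    by rewrite root_branch // eqxx.
  rewrite (eq_bigl [in rcons (place v :: q) (tree_root T)]) => [|s].
    by rewrite -big_uniq // big_rcons /= con0 expn0 addn1.
  have [to from] : on_path adj (place v) (tree_root T) s <->
      s \in rcons (place v :: q) (tree_root T).
    rewrite rcons_cons; apply: on_path_uniq => //; first exact: adj_tree.
      by rewrite rcons_path qp lq adjC.
    by rewrite last_rcons.
  by apply/asboolP/idP.
apply/eqP; rewrite eqn_leq; apply/andP; split; last first.
  rewrite -(costE _ _ cost0); apply: (leq_bigmax_cond (place v0)).
  by rewrite place_degree.
apply/bigmax_leqP => s /eqP s1.
(* The root also has degree 1, so the maximum ranges over it too; its path is a single node of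
   weight 1. *)
have [->|sr] := eqVneq s (tree_root T).
  rewrite (big_pred1 (tree_root T)) ?con0 // => x; apply/asboolP/eqP.
    case=> -[|y q] [_ lq uq]; first by rewrite inE => /eqP.
    by move: uq; rewrite -{1}lq /= mem_last.
  by move=> ->; exists [::]; rewrite /= mem_head.
have /place_codom [v ev] : degree adj s = 1 /\ s <> tree_root T by split=> //; apply/eqP.
have [|k kP lek] := le_ft v.
  by rewrite (mem_leaves sh) root_branch // place_neq_root.
by rewrite -ev (costE _ _ kP) ltnS.
Qed.

Lemma weighted_height_spanning :
  exists2 b, spanning b & weighted_height T = (@finish_time R N b).+1.
Proof.
have /eqP/cards1P[t et] := degree_root T.
have rE : adj (tree_root T) =1 pred1 t by move=> s; have /setP/(_ s) := et; rewrite !inE.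
have [||b sh] := @exists_unfolds (tree_root T) t; first by rewrite rE /=.
  by rewrite root_branch // eqxx.
exists b; last exact: weighted_height_unfolds sh.
split=> [|v]; first exact: unfolds_uniq sh.
by rewrite (mem_leaves sh) root_branch // place_neq_root.
Qed.

End Unfolding.

(** * From binary trees to contraction trees *)

Lemma degree_seq (X : finType) (adj : rel X) x (s : seq X) :
  uniq s -> (forall y, adj x y = (y \in s)) -> degree adj x = size s.
Proof.
move=> us xs; rewrite -(card_uniqP us); apply: eq_card => y.
by rewrite inE xs.
Qed.

(** * Trees given by a parent relation *)

Section ParentTree.
Variables (X : finType) (parent : rel X) (rank : X -> nat) (root : X).
Hypothesis parent_rank : forall x y, parent x y -> rank y < rank x.
Hypothesis parent_uniq : forall x x' y, parent x y -> parent x' y -> x = x'.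
Hypothesis parent_ex : forall y, y != root -> exists x, parent x y.

Definition parent_adj : rel X := fun x y => parent x y || parent y x.

Lemma parent_adjC : symmetric parent_adj.
Proof. by move=> x y; rewrite /parent_adj orbC. Qed.

(** Ranks increase strictly from child to parent and are bounded by their maximum, so the climb from
    [x] stops, which happens only at [root]. *)
Lemma connect_parent_root x : connect parent_adj root x.
Proof.
have [n] := ubnP (\max_y rank y - rank x); elim: n x => // n IHn x ltn.
have [->|xr] := eqVneq x root; first exact: connect0.
have [y yx] := parent_ex xr; apply: (@connect_trans _ _ y).
  apply: IHn; apply: leq_trans (_ : \max_y rank y - rank x <= n) => //.
  apply: ltn_sub2l (parent_rank yx); apply: leq_trans (parent_rank yx) _.
  exact: leq_bigmax.
by apply: connect1; rewrite /parent_adj yx.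
Qed.

(* On a cycle, both neighbours of a vertex of minimal rank would be its
   parent. *)
Lemma parent_adj_tree : is_tree parent_adj.
Proof.
split=> [| x | x y | c cyc uc]; first exact: parent_adjC.
- by rewrite /parent_adj orbb; apply/negP => /parent_rank; rewrite ltnn.
- apply: (@connect_trans _ _ root); last exact: connect_parent_root.
  by rewrite (sym_connect_sym parent_adjC) connect_parent_root.
rewrite leqNgt; apply/negP => c3.
have [x0 x0c] : exists x, x \in c.
  by case: c c3 {cyc uc} => // x c _; exists x; rewrite mem_head.
case: (arg_minnP rank x0c) => x xc min_x {x0 x0c}.
have up y : y \in c -> parent_adj x y -> parent y x.
  by move=> /min_x xy /orP[/parent_rank|//]; rewrite ltnNge xy.
(* Once the cycle is rotated to start at [x], the neighbours of [x] are its second vertex [a] and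
   its last vertex [z], which are distinct because there are at least three vertices. *)
have [i p ep] := rot_to xc.
have memp y : y \in x :: p -> y \in c by rewrite -ep mem_rot.
move: cyc uc c3; rewrite -(rot_cycle i) -(rot_uniq i) -(size_rot i) ep.
case: p memp {ep} => [|a p] // memp; case/lastP: p memp => [|p z] // memp.
rewrite /= !rcons_path !last_rcons => /andP[xa /andP[_ zx]].
move=> /andP[_ /andP[anz _]] _.
have pa : parent a x by apply: up xa; apply: memp; rewrite !inE eqxx orbT.
have pz : parent z x.
  by apply: up; rewrite 1?parent_adjC //; apply: memp;
     rewrite !inE mem_rcons mem_head !orbT.
by move: anz; rewrite (parent_uniq pa pz) mem_rcons mem_head.
Qed.

End ParentTree.

Section BtreeChoice.
Variable V : choiceType.

(** The encoding makes [btree V] a choice type, so that the subtrees of a given tree can form a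
    finite type of nodes. *)
Fixpoint btree_encode (b : btree V) : GenTree.tree V :=
  match b with
  | Leaf v => GenTree.Leaf v
  | Node l r => GenTree.Node 0 [:: btree_encode l; btree_encode r]
  end.

Fixpoint btree_decode (t : GenTree.tree V) : option (btree V) :=
  match t with
  | GenTree.Leaf v => Some (Leaf v)
  | GenTree.Node _ [:: l; r] =>
      if (btree_decode l, btree_decode r) is (Some l', Some r')
      then Some (Node l' r') else None
  | _ => None
  end.

Lemma btree_encodeK : pcancel btree_encode btree_decode.
Proof. by elim=> //= l -> r ->. Qed.

End BtreeChoice.

HB.instance Definition _ (V : choiceType) :=
  Choice.copy (btree V) (pcan_type (@btree_encodeK V)).

(** * Subtrees of a binary tree *)

Section Subtrees.
Variable V : choiceType.
Implicit Types (b l r t s : btree V).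

Fixpoint subtrees b : seq (btree V) :=
  b :: if b is Node l r then subtrees l ++ subtrees r else [::].

Definition child t s : bool :=
  if t is Node l r then (s == l) || (s == r) else false.

Lemma subtrees_refl b : b \in subtrees b.
Proof. by case: b => *; rewrite mem_head. Qed.

Lemma subtrees_child b t s : t \in subtrees b -> child t s -> s \in subtrees b.
Proof.
elim: b => [v|l IHl r IHr] /=; rewrite inE; first by move=> /eqP ->.
rewrite inE mem_cat => /orP[/eqP -> /= /orP[] /eqP ->|/orP[] tb ts].
- by rewrite mem_cat subtrees_refl orbT.
- by rewrite mem_cat subtrees_refl !orbT.
- by rewrite mem_cat IHl ?orbT.
- by rewrite mem_cat IHr ?orbT.
Qed.

Lemma subtrees_parent b s : s \in subtrees b -> s != b ->
  exists2 t, t \in subtrees b & child t s.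
Proof.
elim: b => [v|l IHl r IHr] /=; rewrite inE; first by move=> ->.
case: eqVneq => //= _; rewrite mem_cat => /orP[] sb _.
  have [->|/IHl[//|t tl ts]] := eqVneq s l.
    by exists (Node l r); rewrite ?mem_head //= eqxx.
  by exists t; rewrite // inE mem_cat tl orbT.
have [->|/IHr[//|t tr ts]] := eqVneq s r.
  by exists (Node l r); rewrite ?mem_head //= eqxx orbT.
by exists t; rewrite // inE mem_cat tr !orbT.
Qed.

Lemma subtrees_leaf b v : (Leaf v \in subtrees b) = (v \in leaves b).
Proof.
elim: b => [w|l IHl r IHr] /=; rewrite inE; last by rewrite !mem_cat IHl IHr.
by rewrite inE; apply/eqP/eqP => [[]|->].
Qed.

Lemma subtrees_leaves b t : t \in subtrees b -> {subset leaves t <= leaves b}.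
Proof.
elim: b => [v|l IHl r IHr] /=; rewrite inE; first by move=> /eqP ->.
by rewrite mem_cat => /or3P[/eqP -> //|/IHl|/IHr] sub v /sub vb;
   rewrite mem_cat vb ?orbT.
Qed.

Lemma subtrees_uniq b t : uniq (leaves b) -> t \in subtrees b -> uniq (leaves t).
Proof.
elim: b => [v _|l IHl r IHr ub]; first by rewrite inE => /eqP ->.
have [ul ur _] := uniq_leavesN ub; rewrite inE mem_cat.
by move=> /or3P[/eqP ->| |]; [|apply: IHl|apply: IHr].
Qed.

Lemma size_leaves_gt0 b : 0 < size (leaves b).
Proof. by case: (leaves b) (first_leaf_in b). Qed.

Lemma size_leaves_child t s : child t s -> size (leaves s) < size (leaves t).
Proof.
case: t => //= l r /orP[] /eqP ->; rewrite size_cat.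
  by rewrite -[X in X < _]addn0 ltn_add2l size_leaves_gt0.
by rewrite -[X in X < _]add0n ltn_add2r size_leaves_gt0.
Qed.

Lemma size_leaves_subtrees b t :
  t \in subtrees b -> size (leaves t) <= size (leaves b).
Proof.
elim: b => [v|l IHl r IHr] /=; rewrite inE; first by move=> /eqP ->.
rewrite mem_cat size_cat => /or3P[/eqP -> /=|/IHl|/IHr]; first by rewrite size_cat.
  by move=> /leq_trans; apply; apply: leq_addr.
by move=> /leq_trans; apply; apply: leq_addl.
Qed.

(** Subtrees are compared by value, so equal ones at different positions must be excluded. A child
    of a node inside [l] has its first leaf in [l], hence not in [r], and has fewer leaves than [l];
    so it is neither [l], nor [r], nor a child of a node inside [r]. The same holds with the sides
    exchanged. *)
Lemma child_uniq b t t' s : uniq (leaves b) ->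
  t \in subtrees b -> t' \in subtrees b -> child t s -> child t' s -> t = t'.
Proof.
elim: b => [v|l IHl r IHr] ub; first by rewrite !inE => /eqP -> /eqP ->.
have [ul ur lr] := uniq_leavesN ub.
have inner c x y : x \in subtrees c -> child x y ->
    first_leaf y \in leaves c /\ y != c.
  move=> xc xy; split.
    exact: (subtrees_leaves (subtrees_child xc xy)) (first_leaf_in y).
  apply: contraTneq (size_leaves_child xy) => ->.
  by rewrite -leqNgt size_leaves_subtrees.
have apart u v : u \in leaves l -> v \in leaves r -> u = v -> False.
  by move=> ul1 vr euv; have := lr v; rewrite -{1}euv ul1 vr.
have top x y : x \in subtrees l ++ subtrees r -> child x y ->
    child (Node l r) y -> False.
  rewrite mem_cat => /orP[] /inner/[apply] -[yc ync] /= /orP[] /eqP ey.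
  - by rewrite ey eqxx in ync.
  - by apply: (apart _ _ yc (first_leaf_in r)); rewrite ey.
  - by apply: (apart _ _ (first_leaf_in l) yc); rewrite ey.
  - by rewrite ey eqxx in ync.
rewrite /= !inE => /predU1P[->|tb] /predU1P[->|tb'] // ts ts'.
- by case: (top t' s).
- by case: (top t s).
move: tb tb'; rewrite !mem_cat => /orP[] tb /orP[] tb'.
- exact: IHl.
- have [[sl _] [sr _]] := (inner _ _ _ tb ts, inner _ _ _ tb' ts').
  by case: (apart _ _ sl sr).
- have [[sr _] [sl _]] := (inner _ _ _ tb ts, inner _ _ _ tb' ts').
  by case: (apart _ _ sl sr).
- exact: IHr.
Qed.

End Subtrees.

(** * The contraction tree of a contraction order *)

Section TreeOfBtree.
Variables (R : realType) (N : tensor_network R) (b : btree (vertex N)).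
Hypothesis b_spans : spanning b.

Let ub : uniq (leaves b). Proof. by case: b_spans. Qed.

(* [None] is the root. *)
Definition subtree_node : finType := option (seq_sub (subtrees b)).

Definition subtree_parent : rel subtree_node := fun x y =>
  match x, y with
  | None, Some s => val s == b
  | Some t, Some s => child (val t) (val s)
  | _, None => false
  end.

(** The extra root has [b] itself as its child and must rank above it, hence the successor. *)
Definition subtree_rank (x : subtree_node) : nat :=
  if x is Some t then size (leaves (val t)) else (size (leaves b)).+1.

Lemma subtree_parent_rank x y :
  subtree_parent x y -> subtree_rank y < subtree_rank x.
Proof.
by case: x y => [t|] [s|] //=; [apply: size_leaves_child | move/eqP=> ->].
Qed.

Lemma subtree_parent_uniq x x' y :
  subtree_parent x y -> subtree_parent x' y -> x = x'.
Proof.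
have top (t s : seq_sub (subtrees b)) : child (val t) (val s) -> val s != b.
  move=> ts; apply: contraTneq (size_leaves_child ts) => ->.
  by rewrite -leqNgt size_leaves_subtrees // (valP t).
case: y => [s|]; last by case: x.
case: x x' => [t|] [t'|] //=.
- by move=> ts ts'; congr Some; apply: val_inj;
    apply: (child_uniq ub (valP t) (valP t') ts ts').
- by move=> /top/negPf ->.
- by move=> + /top/negPf => ->.
Qed.

Lemma subtree_parent_ex y : y != None -> exists x, subtree_parent x y.
Proof.
case: y => [s|//] _; have [sb|nsb] := eqVneq (val s) b.
  by exists None; rewrite /= sb.
have [t tb ts] := subtrees_parent (valP s) nsb.
by exists (Some (SeqSub tb)).
Qed.

Definition subtree_adj : rel subtree_node := parent_adj subtree_parent.

Lemma subtree_adj_tree : is_tree subtree_adj.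
Proof.
exact: parent_adj_tree subtree_parent_rank subtree_parent_uniq subtree_parent_ex.
Qed.

Definition subtree_place (v : vertex N) : subtree_node :=
  Some (SeqSub (etrans (subtrees_leaf b v) (b_spans.2 v))).

Lemma subtree_adj_leaf p (t : seq_sub (subtrees b)) v :
  val t = Leaf v -> subtree_parent p (Some t) ->
  forall y, subtree_adj (Some t) y = (y \in [:: p]).
Proof.
move=> tv pt y; rewrite inE /subtree_adj /parent_adj.
have -> : subtree_parent (Some t) y = false by case: y => //= s; rewrite tv.
by apply/idP/eqP => [yt|->//]; apply: subtree_parent_uniq yt pt.
Qed.

(** The parent differs from the children by its rank, and the children differ from each other
    because they share no leaf. *)
Lemma subtree_adj_node p (t c d : seq_sub (subtrees b)) :
  val t = Node (val c) (val d) -> subtree_parent p (Some t) ->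
  uniq [:: p; Some c; Some d] /\
  forall y, subtree_adj (Some t) y = (y \in [:: p; Some c; Some d]).
Proof.
move=> tcd pt; have tc : subtree_parent (Some t) (Some c) by rewrite /= tcd /= eqxx.
have td : subtree_parent (Some t) (Some d) by rewrite /= tcd /= eqxx orbT.
have notp s : subtree_parent (Some t) s -> p != s.
  move=> /subtree_parent_rank ts; apply: contraTneq (subtree_parent_rank pt) => ->.
  by rewrite -leqNgt ltnW.
split=> [|y].
  rewrite /= !inE negb_or !notp //= andbT; apply/eqP => -[cd].
  have [_ _ lr] : [/\ uniq (leaves (val c)), uniq (leaves (val d)) & forall v,
      ~~ ((v \in leaves (val c)) && (v \in leaves (val d)))].
    apply: uniq_leavesN; rewrite -tcd.
    exact: subtrees_uniq (valP t).
  by have := lr (first_leaf (val c)); rewrite -cd andbb first_leaf_in.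
rewrite !inE /subtree_adj /parent_adj orbC; congr (_ || _).
  by apply/idP/eqP => [yt|->//]; apply: subtree_parent_uniq yt pt.
by case: y => //= s; rewrite tcd.
Qed.

Lemma subtree_adj_root (t : seq_sub (subtrees b)) : val t = b ->
  forall y, subtree_adj None y = (y \in [:: Some t]).
Proof.
move=> tb y; rewrite inE /subtree_adj /parent_adj.
case: y => [s|] //=; rewrite orbF; apply/eqP/eqP => [sb|[->] //].
by congr Some; apply: val_inj; apply: etrans sb (esym tb).
Qed.

Lemma subtree_degree_root : degree subtree_adj None = 1.
Proof.
exact: (degree_seq _ (subtree_adj_root (t := SeqSub (subtrees_refl b)) erefl)).
Qed.

Lemma subtree_degree (t : seq_sub (subtrees b)) :
  degree subtree_adj (Some t) = if val t is Leaf _ then 1 else 3.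
Proof.
have [p pt] : exists p, subtree_parent p (Some t) by apply: subtree_parent_ex.
case et: (val t) => [v|l r].
  exact: (degree_seq _ (subtree_adj_leaf et pt)).
have lb : l \in subtrees b by apply: (subtrees_child (valP t)); rewrite et /= eqxx.
have rb : r \in subtrees b.
  by apply: (subtrees_child (valP t)); rewrite et /= eqxx orbT.
have [u3 tE] := subtree_adj_node (c := SeqSub lb) (d := SeqSub rb) et pt.
exact: degree_seq u3 tE.
Qed.

Lemma subtree_degree_node x : x != None ->
  degree subtree_adj x = 1 \/ degree subtree_adj x = 3.
Proof.
by case: x => // t _; rewrite subtree_degree; case: (val t); [left|right].
Qed.

Lemma subtree_place_inj : injective subtree_place.
Proof. by move=> u v /Some_inj/(congr1 val)[]. Qed.

Lemma subtree_place_codom x :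
  (exists v, subtree_place v = x) <-> degree subtree_adj x = 1 /\ x <> None.
Proof.
split=> [[v <-]|[]]; first by rewrite subtree_degree.
case: x => // t; rewrite subtree_degree; case et: (val t) => [v|//] _ _.
by exists v; congr Some; apply: val_inj; rewrite et.
Qed.

Definition tree_of_btree : contraction_tree N :=
  ContractionTree subtree_adj_tree subtree_degree_root subtree_degree_node
    subtree_place_inj subtree_place_codom.

(** With this, the height of [tree_of_btree] comes from [weighted_height_unfolds], applied with [b]
    as the unfolding from the root. *)
Lemma tree_of_btree_unfolds (p : node tree_of_btree) (t : seq_sub (subtrees b)) :
  subtree_parent p (Some t) -> unfolds (T := tree_of_btree) p (Some t) (val t).
Proof.
move et: (val t) => t0; elim: t0 p t et => [v|l IHl r IHr] p t et pt.
  have ev : place tree_of_btree v = Some t by congr Some; apply: val_inj.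
  rewrite -ev; constructor=> y; rewrite ev.
  exact: etrans (subtree_adj_leaf et pt y) (mem_seq1 y p).
have lb : l \in subtrees b by apply: (subtrees_child (valP t)); rewrite et /= eqxx.
have rb : r \in subtrees b.
  by apply: (subtrees_child (valP t)); rewrite et /= eqxx orbT.
have [u3 tE] := subtree_adj_node (c := SeqSub lb) (d := SeqSub rb) et pt.
apply: (UnfoldsNode (T := tree_of_btree) u3 tE).
  by apply: IHl; rewrite //= et /= eqxx.
by apply: IHr; rewrite //= et /= eqxx orbT.
Qed.

Lemma weighted_height_tree_of_btree :
  weighted_height tree_of_btree = (finish_time b).+1.
Proof.
pose t0 : seq_sub (subtrees b) := SeqSub (subtrees_refl b).
apply: (@weighted_height_unfolds _ _ tree_of_btree (Some t0)).
  move=> y; apply: etrans (mem_seq1 y (Some t0)).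
  exact: subtree_adj_root.
by apply: (@tree_of_btree_unfolds None t0); rewrite /= eqxx.
Qed.

End TreeOfBtree.

(** * Equality of the two minima *)

Theorem theorem2 (R : realType) (N : tensor_network R)
    (hV : 0 < #|vertex N|) :
  exists B : nat,
    [/\ is_minimum
          (fun h => exists T : contraction_tree N, h = weighted_height T) B,
        exists (P : seq (instruction (vertex N))) (A : tensor R N) (t : nat),
          [/\ contracts P A t, legs A = set0,
              forall x, entry A x = network_value N & t <= B] &
        is_minimum
          (fun m => exists (P : seq (instruction (vertex N)))
             (A : tensor R N) (t : nat), contracts P A t /\ m = t + 1) B].
Proof.
(* The least finishing time exists because [hV] provides a spanning tree. *)
pose time m := `[< exists2 b, spanning b & @finish_time R N b = m >].
have ex_time : exists m, time m.
  have [b sb] := exists_spanning hV; exists (@finish_time R N b).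
  by apply/asboolP; exists b.
case: (ex_minnP ex_time) => m /asboolP[b sb <-{m}] min_time.
have min_b b' : spanning b' -> @finish_time R N b <= @finish_time R N b'.
  by move=> sb'; apply: min_time; apply/asboolP; exists b'.
have run_b := @contracts_tree_program R N b sb.
(* The successor is the weight of the root in the height; on the program side it matches the [t + 1]
   of the statement. *)
exists (@finish_time R N b).+1; split.
- split; first by exists (tree_of_btree sb); rewrite weighted_height_tree_of_btree.
  move=> h [T ->]; have [b' sb' ->] := @weighted_height_spanning R N T.
  exact: min_b.
- have [legs0 valueE] := @tree_tensor_value R N b sb.
  by exists (@tree_program R N b), (@tree_tensor R N b), (@finish_time R N b); split.
- split.
    by exists (@tree_program R N b), (@tree_tensor R N b), (@finish_time R N b); rewrite addn1.
  move=> m [P [A [t [runP ->]]]]; have [b' sb' le_t] := contracts_spanning runP.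
  by rewrite addn1 ltnS; apply: leq_trans le_t; apply: min_b.
Qed.
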